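(* There is an absolute constant $\kappa>0$ such that for all integers $N,T\ge2$ and all reals $C,D\ge0$ with $C+D>0$ the following holds. Let $a:=\lceil\ln(T)/2\rceil(4C+2D)$, $b:=C+D$, let $\mathcal{G}$ be the online optimisation game that is the same as the facility location game $\mathrm{FL}(N,C,D)$ except that its complexity function is $\lambda_{\mathcal{G}}(X):=(a|X|+b)/(a+b)$, and for each real $\theta\ge1$ let $\sigma^{\theta}:=\sigma^{\circ}(N,C,D,\lceil(\theta(a+b)-b)/a\rceil)$. Let $\sigma^{\mathrm{DT}}$ be the doubling-trick strategy built from the family $(\sigma^\theta)_{\theta\ge1}$ with parameter $\rho:=(a+b)\sqrt{\ln(2N)/T}$. Then the generalised regret of $\sigma^{\mathrm{DT}}$ with respect to the game $\mathrm{FL}(N,C,D)$ satisfies, for all $L,\Gamma\in[0,\infty)$, $$R(L,\Gamma)\le\kappa\left(L\ln(T)+\Gamma(C+D)\ln(T)\sqrt{\frac{\ln(N)}{T}}\right).$$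
   Context: Notation: $[n]=\{1,\dots,n\}$; $\lceil x\rceil$ is the least positive integer $\ge x$; $\Delta_N$ is the probability simplex in $\mathbb{R}^N$; $\Delta_S$ is the set of probability measures on a set $S$. Online optimisation game (OOG), $T$ trials: an action set $\mathcal{X}$, a set $\mathcal{F}$ of loss functions $\mathcal{X}\to[0,\infty)$, a complexity function $\lambda:\mathcal{X}\to[0,\infty]$. A strategy is $\sigma=(\sigma_1,\dots,\sigma_T)$ with $\sigma_t:\mathcal{F}^T\to\Delta_{\mathcal{X}}$ such that $\sigma_t(f)$ depends only on $f_1,\dots,f_{t-1}$. Its expected average loss is $\mathcal{L}(\sigma,f)=\frac1T\sum_{t=1}^T\int f_t\,d\sigma_t(f)$. Its generalised regret is $R(L,\Gamma)=\sup\mathcal{L}(\sigma,f)$ over all $f\in\mathcal{F}^T$ for which there is $x\in\mathcal{X}$ with $\lambda(x)\le\Gamma$ and $\frac1T\sum_t f_t(x)\le L$ (with $\sup\emptyset=0$). Game $\mathrm{FL}(N,C,D)$: actions are the non-empty subsets $X$ of $[N]$; $\lambda(X)=|X|$; loss functions are $\ell_{c,d}(X)=\sum_{i\in X}c_i+\min_{i\in X}d_i$ for $(c,d)\in[0,C]^N\times[0,D]^N$ (loss functions are regarded as indexed by the pairs $(c,d)$, so strategies may depend on the pairs). Strategy $\sigma^{\bullet}(M,C',D',K)$ for $M$ sites, cost bounds $C',D'$, $K$ a positive integer: let $\Upsilon=K\lceil\ln(T)/2\rceil$, $G=(C'+D')\Upsilon$, $\eta=\frac1G\sqrt{\ln(M)/T}$.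 For a pair $(c,d)$ let $v$ be a permutation of $[M]$ with $d_{v(1)}\ge\dots\ge d_{v(M)}$ and $$\beta_{c,d}(w)=\Upsilon\,c\cdot w+d_{v(M)}+\sum_{i=1}^{M-1}(d_{v(i)}-d_{v(i+1)})\Big(\sum_{j=1}^{i}w_{v(j)}\Big)^{\Upsilon}.$$ Set $w^1=(1/M,\dots,1/M)$ and $w^{t+1}_i\propto w^t_i\exp(-\eta\,\partial_i\beta_{c^t,d^t}(w^t))$, normalised to lie in $\Delta_M$. On trial $t$ the strategy draws $\Upsilon$ independent indices from $[M]$ with distribution $w^t$ and plays the set of drawn indices. Strategy $\sigma^{\circ}(N,C,D,K)$: run $\sigma^{\bullet}(2N,C,C+D,K)$ on the extended pairs $(\hat c,\hat d)$ with $\hat c_i=c_i,\hat d_i=d_i$ for $i\le N$ and $\hat c_i=0,\hat d_i=C+D$ for $N<i\le2N$; if it draws $\hat X\subseteq[2N]$, play $\hat X\cap[N]$ if this is non-empty and $\{1\}$ otherwise. Doubling-trick strategy $\sigma^{\mathrm{DT}}$ built from strategies $(\sigma^\theta)_{\theta\ge1}$ with parameter $\rho$: for $f\in\mathcal{F}^T$ and $0\le\tau<T$ let $f^{[\tau,T]}\in\mathcal{F}^T$ have $t$-th element $f_{t+\tau}$ for $t\le T-\tau$ and the zero loss function (here $\ell_{0,0}$) for $t>T-\tau$. Put $\theta_1=1$, $\tau_1=0$, $\sigma_1^{\mathrm{DT}}(f)=\sigma_1^{\theta_1}(f^{[0,T]})$, $l_1=\int f_1\,d\sigma_1^{\mathrm{DT}}(f)$.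 For $t=1,\dots,T-1$: if $l_t<2\theta_t\rho T$, put $\theta_{t+1}=\theta_t$, $\tau_{t+1}=\tau_t$, $\sigma^{\mathrm{DT}}_{t+1}(f)=\sigma^{\theta_t}_{t+1-\tau_t}(f^{[\tau_t,T]})$, $l_{t+1}=l_t+\int f_{t+1}\,d\sigma^{\mathrm{DT}}_{t+1}(f)$; if $l_t\ge2\theta_t\rho T$, put $\theta_{t+1}=2\theta_t$, $\tau_{t+1}=t$, $\sigma^{\mathrm{DT}}_{t+1}(f)=\sigma^{\theta_{t+1}}_{1}(f^{[t,T]})$, $l_{t+1}=\int f_{t+1}\,d\sigma^{\mathrm{DT}}_{t+1}(f)$. *)

(* Defs.v *)
From HB Require Import structures.
From mathcomp Require Import all_boot all_order all_algebra.
From mathcomp Require Import all_classical all_reals all_analysis.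

Set Implicit Arguments.
Unset Strict Implicit.
Unset Printing Implicit Defensive.

Import Order.TTheory GRing.Theory Num.Theory.
Import numFieldNormedType.Exports.

Local Open Scope ring_scope.

(* Conventions: the sites 1, ..., N are the elements of 'I_N and the trials
   1, ..., T are the elements of 'I_T, so site (or trial) number k is the
   ordinal of value k - 1.  All action sets are finite, so that probability
   measures on them are given by their mass functions. *)

Section PosCeil.
Variable R : realType.

Lemma pceil_ex (x : R) : exists n : nat, (0 < n)%N && (x <= n%:R).
Proof.
exists (Num.bound x).+1; rewrite ltn0Sn /=.
apply: (le_trans (ler_norm x)); apply/ltW.
by apply: (lt_trans (archi_boundP (normr_ge0 x)));
  rewrite /Num.bound normr_id ltr_nat.
Qed.

(* The least positive integer that is at least x. *)
Definition pceil (x : R) : nat := ex_minn (pceil_ex x).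

Lemma pceil_gt0 (x : R) : (0 < pceil x)%N.
Proof. by rewrite /pceil; case: ex_minnP => n /andP[]. Qed.

End PosCeil.

Section Distributions.
Variable R : realType.

Record dist (A : finType) := Dist {
  pmf :> A -> R;
  pmf_ge0 : forall a, 0 <= pmf a;
  pmf_sum1 : \sum_a pmf a = 1 }.

Definition expect (A : finType) (p : dist A) (f : A -> R) : R :=
  \sum_a p a * f a.

Lemma dist_map_ge0 (A B : finType) (g : A -> B) (p : dist A) (b : B) :
  0 <= \sum_(a | g a == b) p a.
Proof. by apply: sumr_ge0 => a _; apply: pmf_ge0. Qed.

Lemma dist_map_sum1 (A B : finType) (g : A -> B) (p : dist A) :
  \sum_b \sum_(a | g a == b) p a = 1.
Proof.
by rewrite -(pmf_sum1 p) (partition_big g xpredT).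
Qed.

(* The image (push-forward) of p under g. *)
Definition dist_map (A B : finType) (g : A -> B) (p : dist A) : dist B :=
  Dist (dist_map_ge0 g p) (dist_map_sum1 g p).

Lemma dist_iid_ge0 (A : finType) (n : nat) (p : dist A)
  (x : {ffun 'I_n -> A}) : 0 <= \prod_i p (x i).
Proof. by apply: prodr_ge0 => i _; apply: pmf_ge0. Qed.

Lemma dist_iid_sum1 (A : finType) (n : nat) (p : dist A) :
  \sum_(x : {ffun 'I_n -> A}) \prod_i p (x i) = 1.
Proof.
rewrite -(bigA_distr_bigA (fun _ a => p a)) /=.
by rewrite big1 // => i _; apply: pmf_sum1.
Qed.

(* The law of n independent draws from p. *)
Definition dist_iid (A : finType) (n : nat) (p : dist A) :
  dist {ffun 'I_n -> A} := Dist (@dist_iid_ge0 A n p) (@dist_iid_sum1 A n p).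

Lemma dist_unif_ge0 (M : nat) (i : 'I_M) : 0 <= M%:R^-1 :> R.
Proof. by rewrite invr_ge0. Qed.

Lemma dist_unif_sum1 (M : nat) (M0 : (0 < M)%N) :
  \sum_(i < M) M%:R^-1 = 1 :> R.
Proof.
by rewrite sumr_const card_ord -[LHS]mulr_natl mulfV // pnatr_eq0 -lt0n.
Qed.

Definition dist_unif (M : nat) (M0 : (0 < M)%N) : dist 'I_M :=
  Dist (@dist_unif_ge0 M) (dist_unif_sum1 M0).

Lemma reweight_den_gt0 (A : finType) (p : dist A) (g : A -> R) :
  0 < \sum_a p a * expR (g a).
Proof.
have h0 a : 0 <= p a * expR (g a) by rewrite mulr_ge0 ?pmf_ge0 ?expR_ge0.
rewrite lt0r sumr_ge0 // andbT; apply/eqP => /psumr_eq0P h.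
have /eqP := pmf_sum1 p; rewrite big1 ?(eq_sym 0) ?oner_eq0 // => a _.
have /eqP := h (fun a _ => h0 a) a isT.
by rewrite mulf_eq0 (gt_eqF (expR_gt0 _)) orbF => /eqP.
Qed.

Lemma reweight_ge0 (A : finType) (p : dist A) (g : A -> R) (a : A) :
  0 <= p a * expR (g a) / \sum_b p b * expR (g b).
Proof.
rewrite divr_ge0 ?mulr_ge0 ?pmf_ge0 ?expR_ge0 //.
exact/ltW/reweight_den_gt0.
Qed.

Lemma reweight_sum1 (A : finType) (p : dist A) (g : A -> R) :
  \sum_a p a * expR (g a) / (\sum_b p b * expR (g b)) = 1.
Proof. by rewrite -mulr_suml mulfV // gt_eqF // reweight_den_gt0. Qed.

(* The distribution proportional to p a * exp (g a). *)
Definition dist_reweight (A : finType) (p : dist A) (g : A -> R) : dist A :=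
  Dist (reweight_ge0 p g) (reweight_sum1 p g).

End Distributions.

Section OnlineOptimisation.
Variable R : realType.

(* The loss functions are the functions loss k for k : loss_index. *)
Record oog := OOG {
  action : finType;
  loss_index : Type;
  loss : loss_index -> action -> R;
  complexity : action -> \bar R;
  loss_ge0 : forall k x, 0 <= loss k x;
  complexity_ge0 : forall x, (0 <= complexity x)%E }.

(* Strategies see the actions and the loss indices but not the complexity
   function, hence they are shared by games that differ only in the latter. *)
Record strategy (T : nat) (A : finType) (F : Type) := Strategy {
  play :> 'I_T -> ('I_T -> F) -> dist R A;
  play_causal : forall (t : 'I_T) (f f' : 'I_T -> F),
    (forall s : 'I_T, (s < t)%N -> f s = f' s) -> play t f = play t f' }.

Definition avg_loss (T : nat) (G : oog)
    (sigma : strategy T (action G) (loss_index G))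
    (f : 'I_T -> loss_index G) : R :=
  T%:R^-1 * \sum_(t < T) expect (sigma t f) (loss (f t)).

(* The generalised regret.  Losses are non-negative, so adjoining 0 to the set
   only serves to make the supremum of the empty set equal to 0. *)
Definition regret (T : nat) (G : oog)
    (sigma : strategy T (action G) (loss_index G)) (L Gamma : R) : \bar R :=
  ereal_sup ([set 0%E] `|`
    [set (avg_loss sigma f)%:E | f in
      [set f : 'I_T -> loss_index G |
        exists x : action G, (complexity x <= Gamma%:E)%E /\
          T%:R^-1 * \sum_(t < T) loss (f t) x <= L]])%classic.

End OnlineOptimisation.

Section Doubling.
Variables (R : realType) (T : nat) (G : oog R).
Variables (zero : loss_index G) (rho : R).
Variable sig : R -> strategy R T (action G) (loss_index G).

(* The sequence f_(tau+1), ..., f_T, padded with zero. *)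
Definition pad_tail (tau : nat) (f : 'I_T -> loss_index G) :
    'I_T -> loss_index G :=
  fun t => oapp f zero (insub (t + tau)%N).

Definition ord_sub (t : 'I_T) (k : nat) : 'I_T :=
  Ordinal (leq_ltn_trans (leq_subr k t) (ltn_ord t)).

Definition phase_play (theta : R) (tau : nat) (t : 'I_T)
    (f : 'I_T -> loss_index G) : dist R (action G) :=
  sig theta (ord_sub t tau) (pad_tail tau f).

Definition phase_loss (theta : R) (tau : nat) (t : 'I_T)
    (f : 'I_T -> loss_index G) : R :=
  expect (phase_play theta tau t f) (loss (f t)).

(* The triple (theta, tau, l) of the trial of ordinal value t.  As tau counts
   the trials completed before the current phase, it is also the ordinal value
   of the first trial of that phase. *)
Fixpoint dt_state (f : 'I_T -> loss_index G) (t : nat) :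
    (t < T)%N -> R * nat * R :=
  match t return (t < T)%N -> R * nat * R with
  | 0 => fun lt_0T => (1, 0%N, phase_loss 1 0 (Ordinal lt_0T) f)
  | s.+1 => fun lt_sT =>
      let: (theta, tau, l) := dt_state f (ltnW lt_sT) in
      let u := Ordinal lt_sT in
      if l < 2 * theta * rho * T%:R
      then (theta, tau, l + phase_loss theta tau u f)
      else (2 * theta, s.+1, phase_loss (2 * theta) s.+1 u f)
  end.

Definition dt_play (t : 'I_T) (f : 'I_T -> loss_index G) :
    dist R (action G) :=
  let: (theta, tau, _) := dt_state f (ltn_ord t) in phase_play theta tau t f.

Lemma phase_play_causal theta tau (t : 'I_T) f f' : (tau <= t)%N ->
  (forall s : 'I_T, (s < t)%N -> f s = f' s) ->
  phase_play theta tau t f = phase_play theta tau t f'.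
Proof.
move=> le_tau eq_f; apply: play_causal => s /= lt_s; rewrite /pad_tail.
by case: insubP => //= u _ val_u; apply: eq_f;
  rewrite val_u addnC -ltn_subRL.
Qed.

Lemma phase_loss_causal theta tau (t : 'I_T) f f' : (tau <= t)%N ->
  (forall s : 'I_T, (s <= t)%N -> f s = f' s) ->
  phase_loss theta tau t f = phase_loss theta tau t f'.
Proof.
move=> le_tau eq_f; rewrite /phase_loss eq_f //.
by rewrite (phase_play_causal theta le_tau (f' := f')) // => s /ltnW /eq_f.
Qed.

Lemma dt_state_tau f t (lt_tT : (t < T)%N) : ((dt_state f lt_tT).1.2 <= t)%N.
Proof.
elim: t lt_tT => //= t IH lt_tT; have := IH (ltnW lt_tT).
case: (dt_state _ _) => [[theta tau] l] /= le_tau.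
by case: ifP => _ //=; apply: leqW.
Qed.

Lemma dt_state_causal f f' t (lt_tT : (t < T)%N) :
  (forall s : 'I_T, (s <= t)%N -> f s = f' s) ->
  dt_state f lt_tT = dt_state f' lt_tT.
Proof.
elim: t lt_tT => /= [|t IH] lt_tT eq_f.
  by rewrite (phase_loss_causal 1 (t := Ordinal lt_tT) _ eq_f).
have := dt_state_tau f' (ltnW lt_tT).
rewrite (IH (ltnW lt_tT)); last by move=> s /leqW /eq_f.
case: (dt_state _ _) => [[theta tau] l] /= le_tau.
rewrite (phase_loss_causal _ (t := Ordinal lt_tT) _ eq_f) ?leqW //.
by rewrite (phase_loss_causal _ (t := Ordinal lt_tT) (leqnn _) eq_f).
Qed.

Lemma dt_phase_causal f f' t (lt_tT : (t < T)%N) :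
  (forall s : 'I_T, (s < t)%N -> f s = f' s) ->
  (dt_state f lt_tT).1 = (dt_state f' lt_tT).1.
Proof.
case: t lt_tT => //= t lt_tT eq_f.
rewrite (@dt_state_causal f f') //.
by case: (dt_state _ _) => [[theta tau] l]; case: ifP.
Qed.

Lemma dt_play_causal (t : 'I_T) f f' :
  (forall s : 'I_T, (s < t)%N -> f s = f' s) -> dt_play t f = dt_play t f'.
Proof.
move=> eq_f; rewrite /dt_play.
have := dt_state_tau f' (ltn_ord t).
have := dt_phase_causal (ltn_ord t) eq_f.
case: (dt_state f _) => [[theta tau] l] /=.
case: (dt_state f' _) => [[theta' tau'] l'] /= [-> ->] le_tau.
exact: phase_play_causal.
Qed.

Definition doubling : strategy R T (action G) (loss_index G) :=
  Strategy dt_play_causal.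

End Doubling.

Section FacilityLocation.
Variable R : realType.

Record fl_pair (N : nat) (C D : {nonneg R}) := FLPair {
  fl_c : 'I_N -> R;
  fl_d : 'I_N -> R;
  fl_cP : forall i, 0 <= fl_c i <= C%:num;
  fl_dP : forall i, 0 <= fl_d i <= D%:num }.

Definition sites (N : nat) : finType := {X : {set 'I_N} | X != finset.set0}.

(* As d <= D and X is non-empty, the default value D does not affect the
   minimum. *)
Definition fl_loss (N : nat) (C D : {nonneg R}) (k : fl_pair N C D)
    (X : sites N) : R :=
  \sum_(i in val X) fl_c k i + \big[Num.min/D%:num]_(i in val X) fl_d k i.

Lemma fl_loss_ge0 N C D (k : fl_pair N C D) (X : sites N) : 0 <= fl_loss k X.
Proof.
rewrite addr_ge0 //.
  by apply: sumr_ge0 => i _; case/andP: (fl_cP k i).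
apply: (big_ind (fun x : R => 0 <= x)) => // [x y x0 y0|i _].
  by rewrite le_min x0.
by case/andP: (fl_dP k i).
Qed.

Lemma card_ge0 N (X : sites N) : (0 <= #|val X|%:R%:E :> \bar R)%E.
Proof. by rewrite lee_fin. Qed.

Definition FL (N : nat) (C D : {nonneg R}) : oog R :=
  OOG (@fl_loss_ge0 N C D) (@card_ge0 N).

Lemma affine_card_ge0 N (a b : {nonneg R}) (X : sites N) :
  (0 <= ((a%:num * #|val X|%:R + b%:num) / (a%:num + b%:num))%:E)%E.
Proof. by rewrite lee_fin. Qed.

(* FL N C D with complexity (a |X| + b) / (a + b). *)
Definition FL_affine (N : nat) (C D a b : {nonneg R}) : oog R :=
  OOG (@fl_loss_ge0 N C D) (@affine_card_ge0 N a b).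

Lemma zero_bound (N : nat) (E : {nonneg R}) (i : 'I_N) :
  0 <= (0 : R) <= E%:num.
Proof. by rewrite lexx /=. Qed.

Definition fl_zero (N : nat) (C D : {nonneg R}) : fl_pair N C D :=
  FLPair (zero_bound (N := N) C) (zero_bound (N := N) D).

Section Bullet.
Variables (T M : nat) (M0 : (0 < M)%N) (C D : {nonneg R}).
Variables (K : nat) (K0 : (0 < K)%N).

Definition upsilon : nat := (K * pceil (ln T%:R / 2 : R))%N.

Lemma upsilon_gt0 : (0 < upsilon)%N.
Proof. by rewrite muln_gt0 K0 pceil_gt0. Qed.

Definition bullet_eta : R :=
  ((C%:num + D%:num) * upsilon%:R)^-1 * Num.sqrt (ln M%:R / T%:R).

(* For 1 <= i <= M, the i-th site in non-increasing order of d.  The order of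
   ties does not affect bullet_beta below. *)
Definition site_rank (d : 'I_M -> R) (i : nat) : 'I_M :=
  nth (Ordinal M0) (sort (fun j k => d k <= d j) (enum 'I_M)) i.-1.

Definition bullet_beta (k : fl_pair M C D) (w : 'I_M -> R) : R :=
  let c := fl_c k in let d := fl_d k in let v := site_rank d in
  upsilon%:R * (\sum_(i < M) c i * w i) + d (v M) +
  \sum_(1 <= i < M)
    (d (v i) - d (v i.+1)) * (\sum_(1 <= j < i.+1) w (v j)) ^+ upsilon.

Definition bullet_partial (k : fl_pair M C D) (i : 'I_M) (w : 'I_M -> R) : R :=
  ((fun x : R => bullet_beta k (fun j => if j == i then x else w j))^`()
    (w i))%classic.

Definition bullet_update (w : dist R 'I_M) (k : fl_pair M C D) : dist R 'I_M :=
  dist_reweight w (fun i => - bullet_eta * bullet_partial k i w).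

Definition bullet_weights (f : 'I_T -> fl_pair M C D) (t : 'I_T) :
    dist R 'I_M :=
  foldl bullet_update (dist_unif R M0)
    [seq f s | s : 'I_T <- enum 'I_T & (s < t)%N].

Lemma drawn_neq0 (x : {ffun 'I_upsilon -> 'I_M}) :
  [set x j | j : 'I_upsilon]%SET != finset.set0.
Proof.
by apply/finset.set0Pn; exists (x (Ordinal upsilon_gt0)); apply: imset_f.
Qed.

Definition drawn (x : {ffun 'I_upsilon -> 'I_M}) : sites M :=
  exist _ [set x j | j : 'I_upsilon]%SET (drawn_neq0 x).

Definition bullet_play (t : 'I_T) (f : 'I_T -> fl_pair M C D) :
    dist R (sites M) :=
  dist_map drawn (dist_iid upsilon (bullet_weights f t)).

Lemma bullet_causal (t : 'I_T) f f' :
  (forall s : 'I_T, (s < t)%N -> f s = f' s) ->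
  bullet_play t f = bullet_play t f'.
Proof.
move=> eq_f; rewrite /bullet_play /bullet_weights; congr dist_map.
congr (dist_iid _ (foldl _ _ _)); apply/eq_in_map => s.
by rewrite mem_filter => /andP[/eq_f].
Qed.

Definition bullet : strategy R T (sites M) (fl_pair M C D) :=
  Strategy bullet_causal.

End Bullet.

Section Circ.
Variables (T N : nat) (N0 : (0 < N)%N) (C D : {nonneg R}).
Variables (K : nat) (K0 : (0 < K)%N).

Let CD : {nonneg R} := (C%:num + D%:num)%:nng.

(* Indices i <= N and N < i <= 2N correspond to inl and inr under split. *)
Definition ext_c (k : fl_pair N C D) (i : 'I_(N + N)) : R :=
  if fintype.split i is inl j then fl_c k j else 0.

Definition ext_d (k : fl_pair N C D) (i : 'I_(N + N)) : R :=
  if fintype.split i is inl j then fl_d k j else C%:num + D%:num.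

Lemma ext_cP k i : 0 <= ext_c k i <= C%:num.
Proof.
by rewrite /ext_c; case: fintype.split => j; [apply: fl_cP | rewrite lexx /=].
Qed.

Lemma ext_dP k i : 0 <= ext_d k i <= CD%:num.
Proof.
rewrite /ext_d; case: fintype.split => j /=; last by rewrite lexx andbT.
by case/andP: (fl_dP k j) => -> /le_trans -> //; rewrite lerDr.
Qed.

Definition ext_pair (k : fl_pair N C D) : fl_pair (N + N) C CD :=
  FLPair (ext_cP k) (ext_dP k).

Lemma site1_neq0 : [set Ordinal N0]%SET != finset.set0.
Proof. by apply/finset.set0Pn; exists (Ordinal N0); rewrite inE. Qed.

Definition site1 : sites N := exist _ [set Ordinal N0]%SET site1_neq0.

Definition keep_sites (X : sites (N + N)) : sites N :=
  insubd site1 [set i | lshift N i \in val X]%SET.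

Definition circ_play (t : 'I_T) (f : 'I_T -> fl_pair N C D) :
    dist R (sites N) :=
  dist_map keep_sites
    (bullet T (ltn_addr N N0) C CD K0 t (fun s => ext_pair (f s))).

Lemma circ_causal (t : 'I_T) f f' :
  (forall s : 'I_T, (s < t)%N -> f s = f' s) ->
  circ_play t f = circ_play t f'.
Proof.
move=> eq_f; rewrite /circ_play; congr dist_map.
by apply: play_causal => s /eq_f ->.
Qed.

Definition circ : strategy R T (sites N) (fl_pair N C D) :=
  Strategy circ_causal.

End Circ.

End FacilityLocation.

(* Main.v *)
(* On trial t, the expected loss of the set of Upsilon independent draws from w
   is at most the convex function beta(w), since
   min over X of d = d_v(M) + sum of (d_v(i) - d_v(i+1)) [X within v(1..i)].
   Exponential weights on the gradients of beta, which lie in [0, G], have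
   regret at most 7/4 G sqrt(T ln M).  For a set X of at most K sites, beta at
   the comparator with mass 1/K on each site of X and the rest on a dummy site
   is at most ceil(ln T / 2) times the loss of X, up to the probability
   (1 - 1/K)^Upsilon <= 1/sqrt T of missing the cheapest site of X.  With the
   chosen K, phase theta of the doubling trick thus costs at most
   ceil(ln T / 2) sum_t f_t(X) + 7/4 theta rho T as soon as
   theta >= Lambda := (a |X| + b) / (a + b).  As 7/4 < 2, a phase with such a
   theta that exhausts its budget 2 theta rho T forces
   theta rho T <= 4 ceil(ln T / 2) sum_t f_t(X).  Budgets grow geometrically, so
   the total loss is O(Lambda rho T + ln T sum_t f_t(X)). *)
Require Import Defs.
From HB Require Import structures.
From mathcomp Require Import all_boot all_order all_algebra.
From mathcomp Require Import all_classical all_reals all_analysis.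
From mathcomp Require Import ring lra.

Set Implicit Arguments.
Unset Strict Implicit.
Unset Printing Implicit Defensive.

Import Order.TTheory GRing.Theory Num.Theory.
Import numFieldNormedType.Exports.

Local Open Scope ring_scope.

(** * The expected loss of independent draws *)

Lemma expect_map (R : realType) (A B : finType) (g : A -> B) (p : dist R A)
    (h : B -> R) : expect (dist_map g p) h = \sum_a p a * h (g a).
Proof.
rewrite [RHS](partition_big g xpredT) //; apply: eq_bigr => b _.
by rewrite /= mulr_suml; apply: eq_bigr => a /eqP ->.
Qed.

(** * Layers of the connection costs *)

Section SiteRank.
Variables (R : realType) (M : nat) (M0 : (0 < M)%N) (d : 'I_M -> R).

Definition site_order : seq 'I_M :=
  sort (fun j k => d k <= d j) (enum 'I_M).

(** Counts from 0 whereas [site_rank] counts from 1, so layer [l], the first [l] sites of the order,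
    consists of the sites with [rank i < l]. *)
Definition rank (i : 'I_M) : nat := index i site_order.

Definition gap (k : nat) : R :=
  d (site_rank M0 d k) - d (site_rank M0 d k.+1).

Lemma mem_site_order i : i \in site_order.
Proof. by rewrite mem_sort mem_enum. Qed.

Lemma size_site_order : size site_order = M.
Proof. by rewrite size_sort size_enum_ord. Qed.

Lemma rank_lt i : (rank i < M)%N.
Proof. by rewrite -[X in (_ < X)%N]size_site_order index_mem mem_site_order. Qed.

Lemma site_rankK i : site_rank M0 d (rank i).+1 = i.
Proof. by rewrite /site_rank /= nth_index // mem_site_order. Qed.

Lemma sum_site_rank (w : 'I_M -> R) k : (k <= M)%N ->
  \sum_(1 <= j < k.+1) w (site_rank M0 d j) = \sum_(i | (rank i < k)%N) w i.
Proof.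
move=> kM; rewrite big_add1 /= /site_rank -/site_order.
have sz : size (take k site_order) = k.
  by rewrite size_take size_site_order; case: ltngtP kM.
have un : uniq (take k site_order).
  by rewrite take_uniq // sort_uniq enum_uniq.
rewrite (eq_big_nat _ _
  (F2 := fun j => w (nth (Ordinal M0) (take k site_order) j))); last first.
  by move=> j /andP[_ jk]; rewrite nth_take.
rewrite -{1}sz -(big_nth _ xpredT w) big_uniq //=.
by apply: eq_bigl => i; rewrite in_take ?mem_site_order.
Qed.

Lemma gap_ge0 k : (0 < k < M)%N -> 0 <= gap k.
Proof.
case: k => // k /= kM; rewrite subr_ge0 /site_rank /= -/site_order.
have tot : total (fun j k => d k <= d j) by move=> x y; apply: le_total.
have tr : transitive (fun j k => d k <= d j).
  by move=> x y z xy /le_trans; apply.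
apply: (sorted_ltn_nth tr _ (sort_sorted tot _)) => //;
  rewrite inE size_sort size_enum_ord //; exact: ltnW.
Qed.

Lemma sum_gap_from k : (0 < k <= M)%N ->
  d (site_rank M0 d M) + \sum_(k <= j < M) gap j = d (site_rank M0 d k).
Proof.
move=> /andP[_ kM].
rewrite (telescope_sumr_eq (fun j => - d (site_rank M0 d j))) //; first by ring.
by move=> j _; rewrite /gap; ring.
Qed.

(** Only the layers [j > rank i] contain site [i], and their gaps telescope. *)
Lemma sum_gap_rank i :
  d (site_rank M0 d M) + \sum_(1 <= j < M) (rank i < j)%:R * gap j = d i.
Proof.
rewrite (big_cat_nat (n := (rank i).+1)) ?rank_lt //=.
rewrite big_nat_cond big1 ?add0r; last first.
  by move=> j /andP[/andP[_ ji] _]; rewrite ltnS leqNgt in ji; rewrite (negbTE ji) mul0r.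
rewrite (eq_big_nat _ _ (F2 := gap)); last by move=> j /andP[-> _]; rewrite mul1r.
by rewrite sum_gap_from ?rank_lt // site_rankK.
Qed.

Lemma sum_gap_le (E : R) : (forall i, 0 <= d i <= E) ->
  0 <= \sum_(1 <= j < M) gap j /\
  d (site_rank M0 d M) + \sum_(1 <= j < M) gap j <= E.
Proof.
move=> dE; split; last by rewrite sum_gap_from //; case/andP: (dE (site_rank M0 d 1)).
by rewrite big_nat_cond sumr_ge0 // => j /andP[/gap_ge0].
Qed.

End SiteRank.

(** * The convex surrogate [bullet_beta] *)

Lemma ge_tangent_exp (R : realFieldType) (p q : R) n : 0 <= p -> 0 <= q ->
  p ^+ n + n%:R * p ^+ n.-1 * (q - p) <= q ^+ n.
Proof.
move=> p0 q0; elim: n => [|[|n] IH]; first by rewrite !expr0 /= mul0r mul0r addr0.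
  by rewrite /= expr0 !expr1 mulr1 mul1r addrC subrK.
(* Multiplied by [q], the previous tangent exceeds the new one by a nonnegative multiple of the
   square of [q - p]. *)
have /= := ler_wpM2l q0 IH; rewrite -exprS; apply: le_trans.
rewrite -subr_ge0 (_ : _ - _ = n.+1%:R * p ^+ n * (q - p) ^+ 2).
  by apply: mulr_ge0; [apply: mulr_ge0 => //; apply: exprn_ge0 | apply: sqr_ge0].
by rewrite -(natr1 n.+1) !exprS; ring.
Qed.

Section Beta.
Variables (R : realType) (T M : nat) (M0 : (0 < M)%N) (C D : {nonneg R}).
Variable K : nat.
Variable K0 : (0 < K)%N.
Variable k : fl_pair M C D.

Local Notation Ups := (upsilon R T K).
Local Notation c := (fl_c k).
Local Notation d := (fl_d k).
Local Notation dmin := (d (site_rank M0 d M)).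
Local Notation rk := (rank d).
Local Notation gp := (gap M0 d).
Local Notation mass w l := (\sum_(i | (rk i < l)%N) w i).

Lemma bullet_betaE w : bullet_beta T M0 K k w =
  Ups%:R * (\sum_i c i * w i) + dmin + \sum_(1 <= l < M) gp l * mass w l ^+ Ups.
Proof.
rewrite /bullet_beta; congr (_ + _).
rewrite big_nat_cond [RHS]big_nat_cond; apply: eq_bigr => l /andP[/andP[_ lM] _].
by rewrite sum_site_rank // ltnW.
Qed.

Lemma bullet_partialE i w : bullet_partial T M0 K k i w =
  Ups%:R * c i +
  \sum_(1 <= l < M) gp l * (Ups%:R * mass w l ^+ Ups.-1 * (rk i < l)%:R).
Proof.
(* As a function of coordinate [i] alone, [bullet_beta] is the polynomial [P], so the analytic
   derivative becomes a formal one; [lin l] is the mass of layer [l]. *)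
pose lin l : {poly R} := (rk i < l)%:R *: 'X + (mass w l - (rk i < l)%:R * w i)%:P.
pose P : {poly R} := Ups%:R *: (c i *: 'X + (\sum_(j | j != i) c j * w j)%:P)
  + dmin%:P + \sum_(1 <= l < M) gp l *: lin l ^+ Ups.
have massE x l : mass (fun j => if j == i then x else w j) l =
    mass w l - (rk i < l)%:R * w i + (rk i < l)%:R * x.
  case: (boolP (rk i < l)%N) => il; last first.
    rewrite mul0r subr0 mul0r addr0; apply: eq_bigr => j jl.
    by case: eqP jl il => // ->  ->.
  rewrite !mul1r (bigD1 i) //= [mass w l](bigD1 i) //= eqxx.
  rewrite (eq_bigr w); first by ring.
  by move=> j /andP[_ /negbTE ->].
have betaE : (fun x => bullet_beta T M0 K k (fun j => if j == i then x else w j)) =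
    horner P.
  apply/funext => x.
  rewrite bullet_betaE !(hornerE, horner_sum); congr (_ * _ + _ + _).
    rewrite (bigD1 i) //= eqxx; congr (_ + _).
    by apply: eq_bigr => j /negbTE ->.
  apply: eq_bigr => l _; rewrite massE hornerZ horner_exp hornerD hornerZ.
  by rewrite hornerX hornerC [_ * x + _]addrC.
rewrite /bullet_partial betaE.
rewrite derive1E (@derive_val _ _ _ _ _ _ _ (is_derive_poly P (w i))) /P.
rewrite !derivD derivZ derivD derivZ derivX !derivC !addr0 raddf_sum hornerD.
rewrite !hornerZ hornerC mulr1 horner_sum; congr (_ + _).
apply: eq_bigr => l _; rewrite /= derivZ deriv_exp hornerZ hornerMn hornerM.
rewrite horner_exp derivD derivZ derivX derivC !(hornerD, hornerZ, hornerX, hornerC).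
rewrite addr0 mulr1 [X in X ^+ _]addrC subrK -mulr_natl; 
congr (_ * _); exact: etrans (mulrCA _ _ _) (mulrC _ _).
Qed.

(** Each layer contributes a nonnegative gap times a power of a linear form, which lies above its
    tangents; the other terms are affine. *)
Lemma bullet_beta_convex (w u : 'I_M -> R) :
  (forall i, 0 <= w i) -> (forall i, 0 <= u i) ->
  bullet_beta T M0 K k w - bullet_beta T M0 K k u <=
  \sum_i bullet_partial T M0 K k i w * (w i - u i).
Proof.
move=> w0 u0; rewrite !bullet_betaE.
have aux (x y z A B E : R) : A - B <= E -> x + z + A - (y + z + E) <= x - y + B.
  by lra.
under [leRHS]eq_bigr do rewrite bullet_partialE mulrDl.
rewrite big_split /=.
rewrite (_ : \sum_i Ups%:R * c i * _ =
  Ups%:R * (\sum_i c i * w i) - Ups%:R * (\sum_i c i * u i)); last first.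
  by rewrite -mulrBr -sumrB mulr_sumr; apply: eq_bigr => i _; ring.
rewrite (_ : \sum_i _ * (w i - u i) = \sum_(1 <= l < M)
    gp l * (Ups%:R * mass w l ^+ Ups.-1 * (mass w l - mass u l))); last first.
  under eq_bigr do rewrite mulr_suml.
  rewrite exchange_big /=; apply: eq_bigr => l _.
  move: (mass w l ^+ _) => m.
  rewrite -sumrB [X in _ * (_ * X)]big_mkcond /= !mulr_sumr; apply: eq_bigr => i _.
  by case: (rk i < l)%N => /=; ring.
suff : \sum_(1 <= l < M) gp l * mass w l ^+ Ups +
  \sum_(1 <= l < M) gp l * (Ups%:R * mass w l ^+ Ups.-1 * (mass u l - mass w l))
  <= \sum_(1 <= l < M) gp l * mass u l ^+ Ups.
  rewrite (_ : \sum_(1 <= l < M) gp l * (_ * (mass u l - mass w l)) =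
    - \sum_(1 <= l < M)
      gp l * (Ups%:R * mass w l ^+ Ups.-1 * (mass w l - mass u l))); first exact: aux.
  by rewrite -sumrN; apply: eq_bigr => l _; rewrite -mulrN -mulrN opprB.
rewrite -big_split /= big_nat_cond [leRHS]big_nat_cond; apply: ler_sum => l.
rewrite andbT => lM; rewrite -mulrDr ler_wpM2l ?gap_ge0 //.
by apply: ge_tangent_exp; apply: sumr_ge0.
Qed.

Lemma bullet_partial_ge0 i (w : 'I_M -> R) : (forall i, 0 <= w i) ->
  0 <= bullet_partial T M0 K k i w.
Proof.
move=> w0; rewrite bullet_partialE addr_ge0 //.
  by rewrite mulr_ge0 //; case/andP: (fl_cP k i).
rewrite big_nat_cond; apply: sumr_ge0 => l; rewrite andbT => lM.
by rewrite mulr_ge0 ?gap_ge0 // !mulr_ge0 // exprn_ge0 // sumr_ge0.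
Qed.

Lemma mass_le1 (w : 'I_M -> R) l : (forall i, 0 <= w i) -> \sum_i w i = 1 ->
  mass w l <= 1.
Proof.
move=> w0 w1; rewrite -w1 big_mkcond /=; apply: ler_sum => i _.
by case: ifP.
Qed.

(** On the simplex each layer has mass at most 1, and the gaps sum to at most [D]. *)
Lemma bullet_partial_le i (w : 'I_M -> R) :
  (forall i, 0 <= w i) -> \sum_i w i = 1 ->
  bullet_partial T M0 K k i w <= (C%:num + D%:num) * Ups%:R.
Proof.
move=> w0 w1; rewrite bullet_partialE mulrDl; apply: lerD.
  by rewrite mulrC ler_wpM2r //; case/andP: (fl_cP k i).
have [g0 gD] := sum_gap_le M0 (fl_dP k).
apply: (@le_trans _ _ (\sum_(1 <= l < M) gp l * Ups%:R)); last first.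
  rewrite -mulr_suml ler_wpM2r //; apply: le_trans gD.
  by rewrite lerDr; case/andP: (fl_dP k (site_rank M0 d M)).
rewrite big_nat_cond [leRHS]big_nat_cond; apply: ler_sum => l.
rewrite andbT => lM; rewrite ler_wpM2l ?gap_ge0 // -mulrA ler_piMr //.
apply: mulr_ile1 => //; first by rewrite exprn_ge0 // sumr_ge0.
  by rewrite exprn_ile1 ?sumr_ge0 ?mass_le1.
by case: (_ < _)%N.
Qed.

(** A crude bound without comparator, which limits the overshoot of a single trial in the doubling
    trick. *)
Lemma bullet_beta_le (w : 'I_M -> R) :
  (forall i, 0 <= w i) -> \sum_i w i = 1 ->
  bullet_beta T M0 K k w <= (C%:num + D%:num) * Ups%:R.
Proof.
move=> w0 w1; rewrite bullet_betaE mulrDl -addrA; apply: lerD.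
  rewrite mulrC ler_wpM2r // -[leRHS]mulr1 -w1 mulr_sumr.
  apply: ler_sum => i _; rewrite ler_wpM2r //; by case/andP: (fl_cP k i).
have [g0 gD] := sum_gap_le M0 (fl_dP k).
apply: (@le_trans _ _ D%:num); last first.
  by rewrite ler_peMr // ler1n upsilon_gt0.
apply: le_trans gD; rewrite lerD2l.
rewrite big_nat_cond [leRHS]big_nat_cond; apply: ler_sum => l.
rewrite andbT => lM; rewrite ler_piMr ?gap_ge0 //.
by rewrite exprn_ile1 ?sumr_ge0 ?mass_le1.
Qed.

(** Layers that contain [j] have mass at most 1 and rebuild [d j]; layers that avoid [j] have mass
    at most [1 - w j], and their gaps total at most [D]. *)
Lemma bullet_beta_le_site (w : 'I_M -> R) j :
  (forall i, 0 <= w i) -> \sum_i w i = 1 ->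
  bullet_beta T M0 K k w <=
  Ups%:R * (\sum_i c i * w i) + d j + D%:num * (1 - w j) ^+ Ups.
Proof.
move=> w0 w1; rewrite bullet_betaE -!addrA lerD2l.
have wj1 : 0 <= 1 - w j.
  by rewrite -w1 (bigD1 j) //= addrAC subrr add0r sumr_ge0.
have [g0 gD] := sum_gap_le M0 (fl_dP k).
have dM0 : 0 <= dmin by case/andP: (fl_dP k (site_rank M0 d M)).
apply: (@le_trans _ _ (dmin + (\sum_(1 <= l < M) (rk j < l)%:R * gp l +
   \sum_(1 <= l < M) gp l * (1 - w j) ^+ Ups))); last first.
  rewrite addrA sum_gap_rank lerD2l -mulr_suml ler_wpM2r ?exprn_ge0 //.
  by apply: le_trans gD; rewrite lerDr.
rewrite lerD2l -big_split /=.
rewrite big_nat_cond [leRHS]big_nat_cond; apply: ler_sum => l.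
rewrite andbT => lM; have g := gap_ge0 M0 d lM.
case: (ltnP (rk j) l) => jl.
  rewrite mul1r; apply: (@le_trans _ _ (gp l)).
    by rewrite ler_piMr // exprn_ile1 ?sumr_ge0 ?mass_le1.
  by rewrite lerDl mulr_ge0 // exprn_ge0.
rewrite mul0r add0r ler_wpM2l // lerXn2r ?nnegrE ?sumr_ge0 //.
rewrite -w1 [X in _ <= X - _](bigD1 j) //= [leRHS]addrAC subrr add0r.

rewrite big_mkcond [leRHS]big_mkcond /=; apply: ler_sum => i _.
case: eqP => [->|_]; first by rewrite ltnNge jl.
by rewrite /=; case: ifP.
Qed.

(** * Independent draws *)

Lemma sumr_iid_prod (n : nat) (p : dist R 'I_M) (F : 'I_M -> R) :
  \sum_(x : {ffun 'I_n -> 'I_M}) (\prod_j p (x j)) * \prod_j F (x j) =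
  (\sum_i p i * F i) ^+ n.
Proof.
under eq_bigr do rewrite -big_split /=.
rewrite -(bigA_distr_bigA (fun _ i => p i * F i)) /=.
by rewrite prodr_const card_ord.
Qed.

Lemma sumr_iid_coord (n : nat) (p : dist R 'I_M) (F : 'I_M -> R) (j : 'I_n) :
  \sum_(x : {ffun 'I_n -> 'I_M}) (\prod_l p (x l)) * F (x j) =
  \sum_i p i * F i.
Proof.
(* [F (x j)] becomes a product with factor 1 off coordinate [j], so that the sum over all draws
   factorises. *)
have e (x : {ffun 'I_n -> 'I_M}) : (\prod_l p (x l)) * F (x j) =
    \prod_l (p (x l) * if l == j then F (x l) else 1).
  by rewrite big_split /= -big_mkcond big_pred1_eq.
rewrite (eq_bigr _ (fun x _ => e x)).
rewrite -(bigA_distr_bigA (fun l i => p i * if l == j then F i else 1)) /=.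
rewrite (bigD1 j) //= eqxx [X in _ * X]big1 ?mulr1 // => l /negbTE ->.
by under eq_bigr do rewrite mulr1; exact: pmf_sum1.
Qed.

Lemma min_drawn_le (x : {ffun 'I_Ups -> 'I_M}) :
  \big[Num.min/D%:num]_(i in val (drawn K0 x)) d i <=
  dmin + \sum_(1 <= l < M) gp l * \prod_j (rk (x j) < l)%:R.
Proof.
have j0 : 'I_Ups := Ordinal (upsilon_gt0 R T K0).
(* The drawn site of largest rank is a cheapest one, and a layer that contains it contains every
   drawn site. *)
pose j := [arg max_(j > j0 | true) rk (x j)]%N.
have jmax i : (rk (x i) <= rk (x j))%N.
  by rewrite /j; case: arg_maxnP => // m _; apply.
apply: (@le_trans _ _ (d (x j))).
  by apply: bigmin_le_cond; rewrite /= imset_f.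
rewrite -(sum_gap_rank M0 d (x j)) lerD2l.
rewrite big_nat_cond [leRHS]big_nat_cond; apply: ler_sum => l.
rewrite andbT => lM; have g := gap_ge0 M0 d lM.
rewrite mulrC ler_wpM2l //; case: (ltnP (rk (x j)) l) => jl; last first.
  by rewrite prodr_ge0.
by rewrite big1 // => i _; rewrite (leq_ltn_trans (jmax i) jl).
Qed.

(** A site drawn several times is paid for once on the left and once per draw on the right. *)
Lemma sum_drawn_le (x : {ffun 'I_Ups -> 'I_M}) :
  \sum_(i in val (drawn K0 x)) c i <= \sum_j c (x j).
Proof.
rewrite (partition_big x xpredT) //= big_mkcond; apply: ler_sum => i _.
have c0 : 0 <= c i by case/andP: (fl_cP k i).
have -> : \sum_(j | x j == i) c (x j) = \sum_(j | x j == i) c i.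
  by apply: eq_bigr => j /eqP ->.
case: ifP => [/imsetP[j _ ->]|_]; last exact: sumr_ge0.
by rewrite (bigD1 j) //= lerDl sumr_ge0 // => l _; case/andP: (fl_cP k (x j)).
Qed.

(** Each draw has law [w], which gives the opening costs; by independence all draws fall in layer
    [l] with probability its mass to the power [Ups]. *)
Lemma expect_drawn_le (w : dist R 'I_M) :
  expect (dist_map (@drawn R T M K K0) (dist_iid _ w)) (fl_loss k) <=
  bullet_beta T M0 K k w.
Proof.
rewrite expect_map bullet_betaE.
apply: (@le_trans _ _ (\sum_(x : {ffun 'I_Ups -> 'I_M}) (\prod_j w (x j)) *
  (\sum_j c (x j) +
   (dmin + \sum_(1 <= l < M) gp l * \prod_j (rk (x j) < l)%:R)))).
  apply: ler_sum => x _; apply: ler_wpM2l.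
    apply: prodr_ge0 => j _; exact: Defs.pmf_ge0.
  by apply: lerD; [apply: sum_drawn_le | apply: min_drawn_le].
under eq_bigr do rewrite mulrDr mulrDr.
rewrite !big_split /= addrA; apply: lerD; first apply: lerD.
- under eq_bigr do rewrite mulr_sumr.
  rewrite exchange_big /=; under eq_bigr do rewrite sumr_iid_coord.
  rewrite sumr_const card_ord mulr_natl.
  by under eq_bigr do rewrite mulrC.
- by rewrite -mulr_suml (Defs.pmf_sum1 (dist_iid Ups w)) mul1r.
under eq_bigr do rewrite mulr_sumr.
rewrite exchange_big /=; apply: ler_sum => l _.
under eq_bigr do rewrite mulrCA.
rewrite -mulr_sumr (sumr_iid_prod Ups w (fun i => (rk i < l)%:R)).
rewrite [X in _ <= _ * X ^+ _]big_mkcond /=.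
under [X in _ * X ^+ _ <= _]eq_bigr do rewrite mulr_natr mulrb.
by [].
Qed.

End Beta.

(** * Exponential weights *)

(** As [exp x] is at least the square of [1 + x/2], it suffices that this square times the
    right-hand side is at least 1; the coefficient 3/4 makes the quadratic term of that product
    vanish. *)
Lemma expRN_le_quadratic (R : realType) (x : R) : 0 <= x ->
  expR (- x) <= 1 - x + 3 / 4 * x ^+ 2.
Proof.
move=> x0; rewrite expRN -div1r ler_pdivrMr ?expR_gt0 //.
have e0 : 0 <= 1 - x + 3 / 4 * x ^+ 2 by nra.
apply: (@le_trans _ _ ((1 - x + 3 / 4 * x ^+ 2) * (1 + x / 2) ^+ 2)); last first.
  rewrite ler_wpM2l // [X in expR X](_ : x = (x / 2) * 2%:R); last by field.
  by rewrite expRM_natr lerXn2r ?nnegrE ?expR_ge0 ?expR_ge1Dx //; lra.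
have x3 : 0 <= x ^+ 3 by rewrite exprn_ge0.
have x4 : 0 <= x ^+ 4 by rewrite exprn_ge0.
rewrite [leRHS](_ : _ = 1 + x ^+ 3 / 2 + 3 / 16 * x ^+ 4); first lra.
by field.
Qed.

(** By [1 + z <= exp z], the normaliser is at most the exponential of [3/4 B^2] minus the mean of
    [g]. *)
Lemma dist_reweight_ge (R : realType) (A : finType) (w : dist R A)
    (g : A -> R) (B : R) (a : A) :
  (forall b, 0 <= g b <= B) ->
  w a * expR (\sum_b w b * g b - g a - 3 / 4 * B ^+ 2) <=
  dist_reweight w (fun b => - g b) a.
Proof.
move=> gB; rewrite /= ler_pdivlMr ?reweight_den_gt0 // -[leLHS]mulrA.
rewrite ler_wpM2l ?Defs.pmf_ge0 // addrAC expRD mulrC mulrA ler_piMl ?expR_ge0 //.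
have sum_le : \sum_b w b * expR (- g b) <=
    expR (- (\sum_b w b * g b) + 3 / 4 * B ^+ 2).
  apply: le_trans (expR_ge1Dx _).
  apply: (@le_trans _ _ (\sum_b w b * (1 - g b + 3 / 4 * B ^+ 2))).
    apply: ler_sum => b _; rewrite ler_wpM2l ?Defs.pmf_ge0 //.
    have /andP[g0 g1] := gB b; apply: le_trans (expRN_le_quadratic g0) _.
    by rewrite lerD2l ler_wpM2l // lerXn2r ?nnegrE // (le_trans g0).
  under eq_bigr do rewrite mulrDr mulrBr mulr1.
  by rewrite big_split sumrB -mulr_suml !pmf_sum1 mul1r addrA.
apply: le_trans (ler_wpM2r (expR_ge0 _) sum_le) _.
by rewrite -expRD -[leRHS](expR0 R) ler_expR; lra.
Qed.

Section Bullet.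
Variables (R : realType) (T M : nat) (M0 : (0 < M)%N) (C D : {nonneg R}).
Variables (K : nat) (K0 : (0 < K)%N).
Variable f : 'I_T -> fl_pair M C D.

Local Notation Ups := (upsilon R T K).
Local Notation eta := (bullet_eta T M C D K).
Local Notation W := (bullet_weights M0 K f).

(** Extends [bullet_weights] to [n = T], the weights after the last update. *)
Definition weights_upto (n : nat) : dist R 'I_M :=
  foldl (bullet_update T M0 K) (dist_unif R M0)
    [seq f s | s : 'I_T <- enum 'I_T & (s < n)%N].

Lemma weights_uptoS (t : 'I_T) :
  weights_upto t.+1 = bullet_update T M0 K (W t) (f t).
Proof.
rewrite /weights_upto /bullet_weights.
suff -> : [seq s : 'I_T <- enum 'I_T | (s < t.+1)%N] =
    rcons [seq s : 'I_T <- enum 'I_T | (s < t)%N] t by rewrite map_rcons foldl_rcons.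
apply: (inj_map val_inj); rewrite map_rcons.
have filterE n : (n <= T)%N ->
    [seq val s | s : 'I_T <- enum 'I_T & (s < n)%N] = iota 0 n.
  move=> nT; rewrite -(filter_map val (fun i => i < n)%N) val_enum_ord.
  exact: (@filter_iota_ltn 0 T n).
by rewrite !filterE ?ltn_ord // 1?ltnW ?ltn_ord // -addn1 iotaD -cats1.
Qed.

Let grad t i := bullet_partial T M0 K (f t) i (W t).
Let G := (C%:num + D%:num) * Ups%:R.

Lemma weights_upto_ge (j : 'I_M) n : (n <= T)%N ->
  M%:R^-1 * expR (\sum_(t < T | (t < n)%N)
    (eta * (\sum_i W t i * grad t i) - eta * grad t j
     - 3 / 4 * (eta * G) ^+ 2)) <= weights_upto n j.
Proof.
elim: n => [|n IH] nT.
  rewrite big_pred0 // expR0 mulr1 /weights_upto.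
  by rewrite (_ : [seq s <- _ | _] = [::]) // filter_pred0.
pose t := Ordinal nT; rewrite (weights_uptoS t).
have -> : bullet_update T M0 K (W t) (f t) =
    dist_reweight (W t) (fun b => - (eta * grad t b)).
  by rewrite /bullet_update; congr dist_reweight; apply/funext => i; rewrite mulNr.
rewrite (bigD1 t) //.
rewrite (eq_bigl (fun s : 'I_T => s < n)%N) => [|s]; last first.
  by rewrite -val_eqE /= ltnS andbC ltn_neqAle.
rewrite [X in expR X]addrC expRD mulrA.
have eta0 : 0 <= eta.
  by rewrite mulr_ge0 ?sqrtr_ge0 // invr_ge0 mulr_ge0.
have gB i : 0 <= eta * grad t i <= eta * G.
  have W0 := @Defs.pmf_ge0 _ _ (W t).
  rewrite mulr_ge0 ?bullet_partial_ge0 //= ler_wpM2l //.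
  exact: bullet_partial_le (pmf_sum1 _).
apply: le_trans (dist_reweight_ge (W t) j gB).
rewrite (_ : \sum_b W t b * (eta * grad t b) = eta * \sum_b W t b * grad t b).
  by rewrite ler_wpM2r ?expR_ge0 // IH // ltnW.
by rewrite mulr_sumr; apply: eq_bigr => b _; rewrite mulrCA.
Qed.

Lemma bullet_regret (u : 'I_M -> R) : (1 < M)%N -> (0 < T)%N ->
  0 < C%:num + D%:num -> (forall i, 0 <= u i) -> \sum_i u i = 1 ->
  \sum_t expect (bullet_play M0 K0 t f) (fl_loss (f t)) <=
  \sum_t bullet_beta T M0 K (f t) u +
  7 / 4 * T%:R * (G * Num.sqrt (ln M%:R / T%:R)).
Proof.
move=> M1 T0 CD u0 u1.
have G0 : 0 < G by rewrite mulr_gt0 // ltr0n upsilon_gt0.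
have lnM : 0 < ln M%:R :> R by rewrite ln_gt0 // ltr1n.
have T0' : 0 < T%:R :> R by rewrite ltr0n.
set r := Num.sqrt _.
have r0 : 0 < r by rewrite sqrtr_gt0 divr_gt0.
have r2 : r ^+ 2 * T%:R = ln M%:R by rewrite sqr_sqrtr ?divr_ge0 1?ltW // divfK ?gt_eqF.
have etaE : eta = r / G by rewrite /bullet_eta mulrC.
have eta0 : 0 < eta by rewrite etaE divr_gt0.
(* With [ln M = r^2 T] and [eta = r / G], the uniform start costs [ln M / eta = T G r] and the
   quadratic terms cost [3/4 eta G^2 T = 3/4 T G r], whence 7/4. *)
have site_regret j : \sum_t \sum_i W t i * grad t i <=
    \sum_t grad t j + 7 / 4 * T%:R * (G * r).
  have := weights_upto_ge j (leqnn T).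
  (* A final weight is at most 1, so the exponent accumulated for [j] is at most [ln M]. *)
  have : weights_upto T j <= 1.
    rewrite -(pmf_sum1 (weights_upto T)) (bigD1 j) //= lerDl sumr_ge0 // => i _.
    exact: Defs.pmf_ge0.
  move=> /[swap] /le_trans /[apply].
  rewrite ler_pdivrMl ?ltr0n // mulr1 (eq_bigl xpredT) => [|t]; last exact: ltn_ord.
  rewrite -[M%:R in leRHS]lnK ?posrE ?ltr0n // ler_expR.
  rewrite !sumrB sumr_const -!mulr_sumr card_ord -[X in _ - X]mulr_natr.
  rewrite -r2 -mulrBr => h.
  rewrite -lerBlDl -(ler_pM2l eta0).
  have -> : eta * (7 / 4 * T%:R * (G * r)) = 7 / 4 * r ^+ 2 * T%:R.
    by rewrite etaE; field; rewrite gt_eqF.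
  have etaG : (eta * G) ^+ 2 = r ^+ 2 by rewrite etaE divfK ?gt_eqF.
  by move: h; rewrite etaG; lra.
(* The linearised loss of [u] is the [u]-average of those of the single sites. *)
have avg : \sum_t \sum_i W t i * grad t i <=
    \sum_t \sum_i u i * grad t i + 7 / 4 * T%:R * (G * r).
  rewrite -[leLHS]mul1r -u1 mulr_suml.
  apply: le_trans (ler_sum _ (fun j _ => ler_wpM2l (u0 j) (site_regret j))) _.
  under eq_bigr do rewrite mulrDr mulr_sumr.
  by rewrite big_split /= -mulr_suml u1 mul1r exchange_big.
apply: (@le_trans _ _ (\sum_t bullet_beta T M0 K (f t) (W t))).
  by apply: ler_sum => t _; apply: expect_drawn_le.
rewrite -lerBlDl -sumrB; move: avg; rewrite -lerBlDl -sumrB; apply: le_trans.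
apply: ler_sum => t _.
apply: le_trans (bullet_beta_convex _ _ _ _ (@Defs.pmf_ge0 _ _ (W t)) u0) _.
by rewrite -sumrB; apply: ler_sum => i _; rewrite mulrBr ![_ * bullet_partial _ _ _ _ _ _]mulrC.
Qed.

Lemma bullet_loss_le (t : 'I_T) :
  expect (bullet_play M0 K0 t f) (fl_loss (f t)) <= G.
Proof.
apply: le_trans (expect_drawn_le _ _ _ _ _) _.
by apply: bullet_beta_le => //; [apply: Defs.pmf_ge0 | apply: pmf_sum1].
Qed.

End Bullet.

(** * Dummy sites *)

Lemma pceil_ge (R : realType) (x : R) : x <= (pceil x)%:R.
Proof. by rewrite /pceil; case: ex_minnP => n /andP[]. Qed.

Lemma pceil_le (R : realType) (x : R) : 0 <= x -> (pceil x)%:R <= x + 1.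
Proof.
move=> x0; rewrite /pceil; case: ex_minnP => -[|[|n]] // _ nmin.
  by rewrite lerDr.
rewrite -natr1 lerD2r leNgt; apply/negP => /ltW xn.
by have := nmin n.+1; rewrite xn /= ltnn => /(_ isT).
Qed.

Section Circ.
Variables (R : realType) (T N : nat) (N0 : (0 < N)%N) (C D : {nonneg R}).
Variables (K : nat) (K0 : (0 < K)%N).

Local Notation P := (pceil (ln T%:R / 2 : R)).
Local Notation Ups := (upsilon R T K).
Local Notation M0 := (ltn_addr N N0).

Lemma ext_c_lshift (k : fl_pair N C D) i : ext_c k (lshift N i) = fl_c k i.
Proof. by rewrite /ext_c (unsplitK (inl i)). Qed.

Lemma ext_c_rshift (k : fl_pair N C D) i : ext_c k (rshift N i) = 0.
Proof. by rewrite /ext_c (unsplitK (inr i)). Qed.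

Lemma ext_d_lshift (k : fl_pair N C D) i : ext_d k (lshift N i) = fl_d k i.
Proof. by rewrite /ext_d (unsplitK (inl i)). Qed.

Lemma ext_d_rshift (k : fl_pair N C D) i :
  ext_d k (rshift N i) = C%:num + D%:num.
Proof. by rewrite /ext_d (unsplitK (inr i)). Qed.

(** A dummy site has connection cost [C + D], so dropping it is harmless while a real site remains;
    if none remains, site 1 costs at most [C + D] in total. *)
Lemma fl_loss_keep_sites_le (k : fl_pair N C D) (X : sites (N + N)) :
  fl_loss k (keep_sites N0 X) <= fl_loss (ext_pair k) X.
Proof.
rewrite /fl_loss /= /keep_sites /insubd.
have minD (Y : {set 'I_N}) : \big[Num.min/D%:num]_(i in Y) fl_d k i <= C%:num + D%:num.
  by apply: le_trans (bigmin_le_id _ _ _ _) _; rewrite lerDr.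
have ext_sum : \sum_(i in val X) ext_c k i =
    \sum_(i in [set i | lshift N i \in val X]%SET) fl_c k i.
  rewrite big_mkcond big_split_ord /= [X in _ + X]big1 ?addr0 => [|i _]; last first.
    by rewrite ext_c_rshift; case: ifP.
  rewrite -big_mkcond; apply: eq_big => [i|i _]; first by rewrite inE.
  by rewrite ext_c_lshift.
case: insubP => [Y _ valY|] /=.
  rewrite valY ext_sum lerD2l; apply: le_bigmin; first exact: minD.
  move=> i; rewrite -(splitK i); case: (fintype.split i) => j /= Xj.
    by rewrite ext_d_lshift; apply: bigmin_le_cond; rewrite inE.
  by rewrite ext_d_rshift; apply: minD.
rewrite negbK => /eqP Y0; rewrite ext_sum Y0 finset.big_set0 add0r big_set1.
apply: (@le_trans _ _ (C%:num + D%:num)).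
  apply: lerD; first by case/andP: (fl_cP k (Ordinal N0)).
  exact: bigmin_le_id.
apply: le_bigmin => // i; rewrite -(splitK i); case: (fintype.split i) => j /= Xj.
  by have := finset.in_set0 j; rewrite -Y0 inE Xj.
by rewrite ext_d_rshift.
Qed.

Lemma circ_play_le (f : 'I_T -> fl_pair N C D) (t : 'I_T) :
  expect (circ_play N0 K0 t f) (fl_loss (f t)) <=
  expect (bullet_play M0 K0 t (fun s => ext_pair (f s))) (fl_loss (ext_pair (f t))).
Proof.
rewrite expect_map; apply: ler_sum => X _; apply: ler_wpM2l.
  exact: Defs.pmf_ge0.
exact: fl_loss_keep_sites_le.
Qed.

Lemma circ_loss_le (f : 'I_T -> fl_pair N C D) (t : 'I_T) :
  expect (circ_play N0 K0 t f) (fl_loss (f t)) <=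
  (C%:num + (C%:num + D%:num)) * Ups%:R.
Proof. exact: le_trans (circ_play_le f t) (bullet_loss_le M0 K0 _ t). Qed.

Section Comparator.
Variable X : sites N.
Variable XK : (#|val X| <= K)%N.

(* The unused share of the [K] draws is put on a single dummy site, so that it
   does not inflate the opening costs. *)
Let u (i : 'I_(N + N)) : R :=
  match fintype.split i with
  | inl j => if j \in val X then K%:R^-1 else 0
  | inr j => if j == Ordinal N0 then 1 - #|val X|%:R / K%:R else 0
  end.

Let K0R : 0 < K%:R :> R. Proof. by rewrite ltr0n. Qed.

Let u_lshift j : u (lshift N j) = if j \in val X then K%:R^-1 else 0.
Proof. by rewrite /u (unsplitK (inl j)). Qed.

Let u_rshift j : u (rshift N j) =
  if j == Ordinal N0 then 1 - #|val X|%:R / K%:R else 0.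
Proof. by rewrite /u (unsplitK (inr j)). Qed.

Let u_ge0 i : 0 <= u i.
Proof.
rewrite -(splitK i); case: (fintype.split i) => j /=.
  by rewrite u_lshift; case: ifP; rewrite ?invr_ge0.
rewrite u_rshift; case: ifP => // _.
by rewrite subr_ge0 ler_pdivrMr // mul1r ler_nat.
Qed.

Let u_sum1 : \sum_i u i = 1.
Proof.
rewrite big_split_ord /=; under eq_bigr do rewrite u_lshift.
rewrite -big_mkcond sumr_const; under eq_bigr do rewrite u_rshift.
by rewrite -big_mkcond big_pred1_eq -[_^-1 *+ _]mulr_natl addrC subrK.
Qed.

Lemma ext_bullet_beta_le (k : fl_pair N C D) :
  bullet_beta T M0 K (ext_pair k) u <=
  P%:R * fl_loss k X + (C%:num + D%:num) * (1 - K%:R^-1) ^+ Ups.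
Proof.
have [j0 Xj0] : exists j, j \in val X by apply/finset.set0Pn; apply: (valP X).
have P1 : 1 <= P%:R :> R by rewrite ler1n pceil_gt0.
(* A cheapest site [j] of [X] has mass [1 / K]; since [Ups / K = P], the opening costs become [P]
   times those of [X]. *)
have [j Xj minE] : {j | j \in val X &
    \big[Num.min/D%:num]_(i in val X) fl_d k i = fl_d k j}.
  by apply: (eq_bigmin j0) => // i _; case/andP: (fl_dP k i).
apply: le_trans (bullet_beta_le_site T M0 K (ext_pair k) (lshift N j) u_ge0 u_sum1) _.
rewrite /= ext_d_lshift u_lshift Xj lerD2r /fl_loss minE mulrDr; apply: lerD.
  rewrite big_split_ord /= [X in _ + X]big1 ?addr0 => [|i _]; last first.
    by rewrite ext_c_rshift mul0r.
  rewrite (eq_bigr (fun i => if i \in val X then fl_c k i * K%:R^-1 else 0)); last first.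
    by move=> i _; rewrite ext_c_lshift u_lshift; case: ifP => // _; rewrite mulr0.
  rewrite -big_mkcond -mulr_suml /upsilon natrM.
  have cancelK (p s : R) : K%:R * p * (s / K%:R) = p * s.
    by rewrite mulrC mulrA divfK ?gt_eqF // mulrC.
  by rewrite cancelK.
by rewrite ler_peMl //; case/andP: (fl_dP k j).
Qed.

(** Raise [1 - 1 / K <= exp (- 1 / K)] to the power [Ups = K P] and use [P >= ln T / 2]. *)
Lemma expN_upsilon_le :
  (0 < T)%N -> (1 - K%:R^-1) ^+ Ups <= Num.sqrt (T%:R^-1 : R).
Proof.
move=> T0; apply: (@le_trans _ _ (expR (- (ln T%:R / 2)))).
  apply: (@le_trans _ _ (expR (- P%:R))); last by rewrite ler_expR lerN2 pceil_ge.
  rewrite (_ : - P%:R = - K%:R^-1 * Ups%:R); last first.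
    by rewrite /upsilon natrM mulNr mulrA mulVf ?mul1r // gt_eqF.
  rewrite expRM_natr lerXn2r ?nnegrE ?expR_ge0 ?expR_ge1Dx //.
  by rewrite subr_ge0 invf_le1 // ler1n.
rewrite -[leLHS]ger0_norm ?expR_ge0 // -sqrtr_sqr ler_wsqrtr // -expRM_natr.
by rewrite mulNr divfK ?pnatr_eq0 // expRN lnK // posrE ltr0n.
Qed.

Lemma circ_regret (f : 'I_T -> fl_pair N C D) : (0 < T)%N ->
  0 < C%:num + D%:num -> 1 <= ln (2 * N%:R) :> R ->
  \sum_t expect (circ_play N0 K0 t f) (fl_loss (f t)) <=
  P%:R * (\sum_t fl_loss (f t) X) + (C%:num + D%:num) * (T%:R * Num.sqrt (ln (2 * N%:R) / T%:R)) +
  7 / 4 * T%:R * ((C%:num + (C%:num + D%:num)) * Ups%:R *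
    Num.sqrt (ln (2 * N%:R) / T%:R)).
Proof.
move=> T0 CD lnN; set r := Num.sqrt _.
have T0R : 0 < T%:R :> R by rewrite ltr0n.
have NN : (N + N)%:R = 2 * N%:R :> R by rewrite natrD; ring.
have M1 : (1 < N + N)%N by rewrite -addn1 leq_add.
have CD' : 0 < C%:num + (C%:num + D%:num) by rewrite ltr_wpDl.
have := bullet_regret M0 K0 (fun s => ext_pair (f s)) M1 T0 CD' u_ge0 u_sum1.
rewrite NN -/r => reg.
apply: le_trans (ler_sum _ (fun t _ => circ_play_le f t)) _.
apply: le_trans reg _.
rewrite lerD2r; apply: le_trans (ler_sum _ (fun t _ => ext_bullet_beta_le (f t))) _.
rewrite big_split /= -mulr_sumr lerD2l sumr_const card_ord.
rewrite -[leLHS]mulr_natl mulrCA.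
rewrite ler_wpM2l // ler_wpM2l //.
(* As [ln (2 N) >= 1], the miss probability is at most [r]. *)
apply: le_trans (expN_upsilon_le T0) _; rewrite ler_wsqrtr //.
by rewrite ler_pdivlMr // mulVf ?gt_eqF.
Qed.

End Comparator.
End Circ.

(** * The doubling trick *)

Section DoublingBound.
Variables (R : realType) (T : nat) (G : oog R).
Variables (zero : loss_index G) (rho : R).
Variable sig : R -> strategy R T (action G) (loss_index G).
Variable f : 'I_T -> loss_index G.

Local Notation pad tau := (pad_tail zero tau f).
Local Notation ploss theta tau s := (phase_loss zero sig theta tau s f).
Local Notation dtl s :=
  (expect (dt_play zero rho sig s f) (loss (f s))).

(** A phase is an initial segment of this full run on the padded tail, so bounds over exactly [T]
    trials apply whenever the phase ends. *)
Definition restart_loss (theta : R) (tau : nat) : R :=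
  \sum_t expect (sig theta t (pad tau)) (loss (pad tau t)).

Lemma expect_ge0 (A : finType) (p : dist R A) (h : A -> R) :
  (forall a, 0 <= h a) -> 0 <= expect p h.
Proof.
by move=> h0; apply: sumr_ge0 => a _; apply: mulr_ge0; [apply: Defs.pmf_ge0|].
Qed.

Lemma phase_loss_restart theta tau (s : 'I_T) : (tau <= s)%N ->
  ploss theta tau s =
  expect (sig theta (ord_sub s tau) (pad tau)) (loss (pad tau (ord_sub s tau))).
Proof.
move=> tau_s; rewrite /phase_loss /phase_play.
suff -> : pad tau (ord_sub s tau) = f s by [].
rewrite /pad_tail /= subnK //.
by case: insubP => [u _ /val_inj -> //|]; rewrite ltn_ord.
Qed.

Lemma sum_phase_loss_le theta tau (P : pred 'I_T) :
  (forall s, P s -> (tau <= s)%N) ->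
  \sum_(s | P s) ploss theta tau s <= restart_loss theta tau.
Proof.
move=> tauP; pose h t := expect (sig theta t (pad tau)) (loss (pad tau t)).
have h0 t : 0 <= h t by apply: expect_ge0 => a; apply: loss_ge0.
(* The shift sends the trials of a phase to distinct trials of the run; the other trials only add
   nonnegative losses. *)
have inj : {in [set s | P s]%SET &, injective (fun s => ord_sub s tau)}.
  move=> s s'; rewrite !inE => Ps Ps' /(congr1 val) /= ss'.
  apply: val_inj; rewrite /= -(subnK (tauP _ Ps)) ss'.
  exact: subnK (tauP _ Ps').
rewrite (eq_bigr (fun s => h (ord_sub s tau))); last first.
  by move=> s /tauP /phase_loss_restart ->.
rewrite (eq_bigl (fun s => s \in [set s | P s]%SET)) => [|s]; last by rewrite inE.
rewrite -(big_imset h inj) /= big_mkcond; apply: ler_sum => t _.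
by case: ifP => // _; apply: h0.
Qed.

(** Shifting drops the first [tau] losses, and padding adds only zeros. *)
Lemma sum_pad_tail_le (h : loss_index G -> R) tau :
  (forall k, 0 <= h k) -> h zero = 0 ->
  \sum_t h (pad tau t) <= \sum_t h (f t).
Proof.
move=> h0 hz.
apply: (@le_trans _ _ (\sum_(t < T) \sum_(u < T | (t + tau)%N == u) h (f u))).
  apply: ler_sum => t _; rewrite /pad_tail.
  case: insubP => [u _ uE|_] /=; last by rewrite hz sumr_ge0.
  by rewrite (bigD1 u) /= ?uE // lerDl sumr_ge0.
rewrite (exchange_big_dep xpredT) //=; apply: ler_sum => u _.
apply: (@le_trans _ _ (\sum_(t < T | t == ord_sub u tau) h (f u))); last first.
  by rewrite big_pred1_eq.
rewrite big_mkcond [leRHS]big_mkcond /=; apply: ler_sum => t _.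
case: eqP => [tu|_]; last by case: ifP.
suff -> : t == ord_sub u tau by [].
by rewrite -val_eqE /= -tu addnK.
Qed.

Lemma dt_playE t (tT : (t < T)%N) theta tau l :
  dt_state zero rho sig f tT = (theta, tau, l) ->
  dtl (Ordinal tT) = ploss theta tau (Ordinal tT).
Proof.
move=> E.
have E' : dt_state zero rho sig f (ltn_ord (Ordinal tT)) = (theta, tau, l).
  by rewrite -E; congr dt_state; apply: bool_irrelevance.
by rewrite /dt_play E'.
Qed.

Let y := rho * T%:R.

Variable rho0 : 0 <= rho.
(** One trial costs at most a whole budget, so a phase costs at most twice its budget. *)
Variable trial_le : forall theta (t : 'I_T) (f' : 'I_T -> loss_index G),
  1 <= theta -> expect (sig theta t f') (loss (f' t)) <= 2 * theta * y.

Let phase_loss_le theta tau (t : 'I_T) : 1 <= theta -> (tau <= t)%N ->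
  ploss theta tau t <= 2 * theta * y.
Proof. by move=> th1 ?; rewrite phase_loss_restart // trial_le. Qed.

(* The finished phases have parameters 1, 2, ..., theta / 2 and a phase with
   parameter theta costs at most [4 theta y], which sums to [4 (theta - 1) y];
   the last finished phase exceeded its budget. *)
Lemma dt_state_inv t (tT : (t < T)%N) theta tau l :
  dt_state zero rho sig f tT = (theta, tau, l) ->
  [/\ 1 <= theta,
      (tau <= t)%N /\ l = \sum_(s < T | (tau <= s <= t)%N) ploss theta tau s,
      l <= 4 * theta * y,
      \sum_(s < T | (s <= t)%N) dtl s <= l + 4 * (theta - 1) * y &
      theta = 1 \/ exists2 tau', 1 <= theta / 2 &
        theta * y <= restart_loss (theta / 2) tau'].
Proof.
have y0 : 0 <= y by rewrite mulr_ge0.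
elim: t tT theta tau l => [|t IH] tT theta tau l.
  move=> /[dup] /dt_playE dtE [<- <- <-].
  have pl : ploss 1 0 (Ordinal tT) <= 2 * 1 * y by apply: phase_loss_le.
  split; [exact: lexx| | |  |by left].
  - split => //; rewrite (big_pred1 (Ordinal tT)) // => s.
    by rewrite /= -val_eqE /= leqn0.
  - by move: pl; lra.
  rewrite (big_pred1 (Ordinal tT)) => [|s]; last by rewrite /= -val_eqE /= leqn0.
  rewrite (dt_playE (theta := 1) (tau := 0%N) (l := ploss 1 0 (Ordinal tT))) //.
  by rewrite subrr mulr0 mul0r addr0.
move=> /[dup] /dt_playE dtE /=.
have := IH (ltnW tT); case: (dt_state _ _ _ _ _) => [[theta0 tau0] l0].
move=> /(_ _ _ _ erefl) [th1 [tau_t lE] l4 tot prev].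
set u := Ordinal tT.
have sumS (P : pred 'I_T) (F : 'I_T -> R) : P u ->
    \sum_(s < T | P s && (s <= t.+1)%N) F s =
    F u + \sum_(s < T | P s && (s <= t)%N) F s.
  move=> Pu; rewrite (bigD1 u) /= ?Pu ?ltnSn //; apply: (congr1 (fun x => F u + x)).
  apply: eq_bigl => s; rewrite /= -val_eqE /= -andbA; congr andb.
  by rewrite andbC -ltn_neqAle ltnS.
have totS : \sum_(s < T | (s <= t.+1)%N) dtl s =
    dtl u + \sum_(s < T | (s <= t)%N) dtl s.
  exact: (sumS xpredT).
case: ifP => [lt_l|/negbT]; [|rewrite -leNgt => ge_l]; case=> eth etau el.
  rewrite -{}eth -{}etau in dtE *; subst l.
  have pl := phase_loss_le th1 (leqW tau_t : (tau0 <= u)%N).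
  have lt_l' : l0 < 2 * theta0 * y by rewrite mulrA.
  split => //.
  - split; first exact: leqW.
    by rewrite sumS ?leqW // lE addrC.
  - by move: pl lt_l'; lra.
  rewrite totS dtE; move: tot; lra.
rewrite -{}eth -{}etau in dtE *; subst l.
have th2 : 1 <= 2 * theta0 by move: th1; lra.
have pl := phase_loss_le th2 (leqnn u).
have ge_l' : 2 * theta0 * y <= l0 by rewrite mulrA.
have thy : 0 <= theta0 * y by rewrite mulr_ge0 // (le_trans _ th1).
split => //.
- split => //; rewrite (big_pred1 u) // => s.
  by rewrite /= -val_eqE /= -eqn_leq eq_sym.
- by move: pl thy; lra.
(* The closed phase joins the finished ones: [4 (theta0 - 1) y + 4 theta0 y = 4 (2 theta0 - 1)
   y]. *)
- rewrite totS dtE; move: tot l4; lra.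
have halfK : 2 * theta0 / 2 = theta0 by rewrite mulrC mulKf ?pnatr_eq0.
right; exists tau0; rewrite halfK //.
apply: le_trans ge_l' _; rewrite lE; apply: sum_phase_loss_le.
by move=> s /andP[].
Qed.

Lemma doubling_loss_le (Lam B : R) : (0 < T)%N -> 0 <= B -> 1 <= Lam ->
  (forall theta tau, Lam <= theta ->
    restart_loss theta tau <= B + 7 / 4 * theta * y) ->
  \sum_s dtl s <= 64 * B + 16 * Lam * y.
Proof.
move=> T0 B0 Lam1 reg.
have y0 : 0 <= y by rewrite mulr_ge0.
have tT : (T.-1 < T)%N by rewrite prednK.
case E : (dt_state zero rho sig f tT) => [[theta tau] l].
have [th1 _ l4 tot prev] := dt_state_inv E.
rewrite (eq_bigl (fun s : 'I_T => s <= T.-1)%N) => [|s]; last first.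
  by rewrite -ltnS prednK // ltn_ord.
apply: le_trans tot _.
(* The total is at most [8 theta y]. Below [2 Lam] this is at most [16 Lam y]; otherwise the
   exhausted phase [theta / 2 >= Lam] gives [theta y <= B + 7/8 theta y], so [theta y <= 8 B]. *)
have [lt_th|ge_th] := ltrP theta (2 * Lam).
  have := ler_wpM2r y0 (ltW lt_th); move: l4; lra.
case: prev => [th|[tau' _ big]]; first by move: ge_th Lam1; rewrite th; lra.
have := reg (theta / 2) tau'; rewrite ler_pdivlMr // mulrC => /(_ ge_th).
have Lamy : 0 <= Lam * y by rewrite mulr_ge0 // (le_trans _ Lam1).
move: big l4 Lamy y0; lra.
Qed.

End DoublingBound.

(** * Constants and the final bound *)

Lemma fl_loss_zero (R : realType) N (C D : {nonneg R}) (X : sites N) :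
  fl_loss (fl_zero N C D) X = 0.
Proof.
rewrite /fl_loss big1 // add0r; apply/le_anti/andP; split.
  have [j Xj] : exists j, j \in val X by apply/finset.set0Pn; apply: (valP X).
  exact: (bigmin_le_cond _ (fun i => fl_d (fl_zero N C D) i) Xj).
exact: le_bigmin.
Qed.

(** Invert [exp (- 1/2) >= 1 - 1/2]. *)
Lemma ln2_ge_half (R : realType) : 1 / 2 <= ln 2 :> R.
Proof.
rewrite -ler_expR lnK ?posrE // -[leRHS]invrK -[leLHS]invrK -expRN.
rewrite lef_pV2 ?posrE ?expR_gt0 ?invr_gt0 //.
by apply: le_trans (expR_ge1Dx _); lra.
Qed.

(* The number of draws is chosen so that the regret of phase [theta] stays
   strictly below its budget [2 theta rho T]. *)
Lemma pceil_budget (R : realType) (theta a b : R) : 1 <= theta -> 0 < a -> 0 <= b ->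
  a * (pceil ((theta * (a + b) - b) / a))%:R <= 2 * (theta * (a + b) - b).
Proof.
move=> th1 a0 b0.
have h : a <= theta * (a + b) - b.
  have : 1 * (a + b) <= theta * (a + b) by rewrite ler_wpM2r // addr_ge0 // ltW.
  lra.
have x0 : 0 <= (theta * (a + b) - b) / a by rewrite divr_ge0 ?(le_trans _ h) ?ltW.
apply: le_trans (ler_wpM2l (ltW a0) (pceil_le x0)) _.
rewrite mulrDr mulr1 mulrC divfK ?gt_eqF //; lra.
Qed.

Theorem theoremD9 (R : realType) :
  exists kappa : R, 0 < kappa /\
  forall (N T : nat) (hN : (2 <= N)%N) (hT : (2 <= T)%N) (C D : {nonneg R}),
  0 < C%:num + D%:num ->
  let a : {nonneg R} :=
    ((pceil (ln T%:R / 2 : R))%:R * (4 * C%:num + 2 * D%:num))%:nng in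
  let b : {nonneg R} := (C%:num + D%:num)%:nng in
  let G : oog R := FL_affine N C D a b in
  let sigma (theta : R) : strategy R T (action G) (loss_index G) :=
    circ T (ltnW hN) C D
      (pceil_gt0 ((theta * (a%:num + b%:num) - b%:num) / a%:num)) in
  let rho : R :=
    (a%:num + b%:num) * Num.sqrt (ln (2 * N%:R) / T%:R) in
  let sigmaDT : strategy R T (action G) (loss_index G) :=
    doubling (fl_zero N C D : loss_index G) rho sigma in
  forall L Gamma : R, 0 <= L -> 0 <= Gamma ->
  (regret (G := FL N C D) sigmaDT L Gamma <=
    (kappa * (L * ln T%:R +
       Gamma * (C%:num + D%:num) * ln T%:R * Num.sqrt (ln N%:R / T%:R)))%:E)%E.
Proof.
(* The complexity term needs [16 * 25/2 * 2 = 400], which exceeds the [64 * 5/2 = 160] of the loss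
   term. *)
exists 400; split; first by rewrite ltr0n.
move=> N T hN hT C D CD.
set P := pceil (ln T%:R / 2 : R).
move=> a b G sigma rho sigmaDT L Gamma L0 Gamma0.
set r := Num.sqrt (ln (2 * N%:R) / T%:R) in rho sigmaDT *.
have T0 : (0 < T)%N by rewrite ltnW.
have T0R : 0 < T%:R :> R by rewrite ltr0n.
have T1R : 1 <= T%:R :> R by rewrite ler1n.
have N2R : 2 <= N%:R :> R by rewrite ler_nat.
have P1 : 1 <= P%:R :> R by rewrite ler1n pceil_gt0.
have lnT : 1 / 2 <= ln T%:R :> R.
  by apply: le_trans (ln2_ge_half R) _; rewrite ler_ln ?posrE ?ler_nat.
have lnNE : ln (2 * N%:R) = ln 2 + ln N%:R :> R.
  by rewrite lnM ?posrE // (lt_le_trans _ N2R).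
have lnN2 : ln 2 <= ln N%:R :> R by rewrite ler_ln ?posrE // (lt_le_trans _ N2R).
have ln2N : 1 <= ln (2 * N%:R) :> R by have := ln2_ge_half R; lra.
(* [pceil] adds at most 1, and [1 <= 2 ln T]. *)
have PlnT : P%:R <= 5 / 2 * ln T%:R :> R.
  have : 0 <= ln T%:R / 2 :> R by lra.
  by move/pceil_le; rewrite -/P; lra.
have r0 : 0 <= r by apply: sqrtr_ge0.
have r_le : r <= 2 * Num.sqrt (ln N%:R / T%:R).
  rewrite -[2]ger0_norm // -sqrtr_sqr -sqrtrM ?sqr_ge0 // ler_wsqrtr // mulrA.
  rewrite ler_wpM2r ?invr_ge0 ?ltW //; lra.
(* The square of [r T] is [T ln (2 N) >= 1]; this makes a single trial fit into a budget. *)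
have rT1 : 1 <= r * T%:R.
  have : 1 ^+ 2 <= (r * T%:R) ^+ 2.
    rewrite expr1n exprMn sqr_sqrtr; last by rewrite divr_ge0 // ltW // (lt_le_trans _ ln2N).
    rewrite expr2 mulrA divfK ?gt_eqF //; nra.
  by rewrite ler_pXn2r ?nnegrE ?mulr_ge0 // ltW.
have C0 : 0 <= C%:num by [].
have D0 : 0 <= D%:num by [].
have aE : a%:num = P%:R * (4 * C%:num + 2 * D%:num) by [].
have bE : b%:num = C%:num + D%:num by [].
have a0 : 0 < a%:num by rewrite aE mulr_gt0 ?(lt_le_trans _ P1) //; lra.
have b0 : 0 <= b%:num by rewrite bE; lra.
have rho0 : 0 <= rho by rewrite mulr_ge0 // addr_ge0 // ltW.
pose K (theta : R) := pceil ((theta * (a%:num + b%:num) - b%:num) / a%:num).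
(* [a] is twice [P] times [2 C + D], the sum of the cost bounds of the extended game. *)
have UpsE theta : (C%:num + (C%:num + D%:num)) * (upsilon R T (K theta))%:R =
    a%:num * (K theta)%:R / 2.
  by rewrite /upsilon -/P natrM aE; field.
have Ups_le theta : 1 <= theta ->
    (C%:num + (C%:num + D%:num)) * (upsilon R T (K theta))%:R <=
    theta * (a%:num + b%:num) - b%:num.
  by move=> th1; rewrite UpsE; have := pceil_budget th1 a0 b0; rewrite -/(K _); lra.
have trial_le (theta : R) (t : 'I_T) (f' : 'I_T -> loss_index G) : 1 <= theta ->
    expect (sigma theta t f') (loss (f' t)) <= 2 * theta * (rho * T%:R).
  move=> th1; apply: le_trans (circ_loss_le _ _ _ _) _.
  apply: le_trans (Ups_le _ th1) _.
  have s0 : 0 <= theta * (a%:num + b%:num) by rewrite mulr_ge0 ?addr_ge0 // ?ltW //; lra.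
  have := ler_wpM2l s0 rT1; rewrite /rho; lra.
apply: ge_ereal_sup => _ [->|[f [X [/= XG fL]] <-]]; rewrite lee_fin.
  (* The case of the value 0 adjoined to the supremum. *)
  have lnT0 : 0 <= ln T%:R :> R by lra.
  apply: mulr_ge0; first exact: ler0n.
  by rewrite addr_ge0 // mulr_ge0 ?sqrtr_ge0 // mulr_ge0 // mulr_ge0 // ltW.
rewrite lee_fin in XG.
have X1 : 1 <= #|val X|%:R :> R.
  by rewrite ler1n card_gt0; apply: (valP X).
pose Lam := (a%:num * #|val X|%:R + b%:num) / (a%:num + b%:num).
have s0 : 0 < a%:num + b%:num by rewrite ltr_pwDl.
have LamE : Lam * (a%:num + b%:num) = a%:num * #|val X|%:R + b%:num.
  by rewrite divfK ?gt_eqF.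
have Lam1 : 1 <= Lam.
  by rewrite ler_pdivlMr // mul1r lerD2r ler_peMr // ltW.
have S0 : 0 <= \sum_t fl_loss (f t) X by apply: sumr_ge0 => t _; apply: fl_loss_ge0.
have PS0 : 0 <= P%:R * \sum_t fl_loss (f t) X by rewrite mulr_ge0.
have reg theta tau : Lam <= theta ->
    restart_loss (fl_zero N C D : loss_index G) sigma f theta tau <=
    P%:R * (\sum_t fl_loss (f t) X) + 7 / 4 * theta * (rho * T%:R).
  move=> Lth; have th1 := le_trans Lam1 Lth.
  (* [theta >= Lam] means [a |X| + b <= theta (a + b)], so [K theta] draws can afford [X]. *)
  have XK : (#|val X| <= K theta)%N.
    rewrite -(ler_nat R); apply: le_trans (pceil_ge _).
    rewrite ler_pdivlMr // lerBrDr mulrC -LamE.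
    by apply: ler_wpM2r => //; apply: ltW.
  apply: le_trans (circ_regret (ltnW hN) _ XK _ T0 CD ln2N) _.
  rewrite -/P -/r.
  have pad_le := sum_pad_tail_le (G := G) f tau
    (fun k => fl_loss_ge0 k X) (fl_loss_zero C D X).
  have rT0 : 0 <= T%:R * r by rewrite mulr_ge0 // ltW.
  have := ler_wpM2r rT0 (Ups_le _ th1).
  have := ler_wpM2l (ltW (lt_le_trans ltr01 P1)) pad_le.
  (* The gradients are bounded by [theta (a + b) - b]; the subtracted [7/4 b T r] pays for the miss
     term [b T r]. *)
  have brT : 0 <= b%:num * (T%:R * r) by rewrite mulr_ge0.
  move: brT; rewrite /rho bE; lra.
have := doubling_loss_le rho0 trial_le T0 PS0 Lam1 reg.
rewrite /avg_loss; set total := \sum_(s < T) _ => total_le.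
have avg_le : T%:R^-1 * total <=
    64 * P%:R * L + 16 * (a%:num * #|val X|%:R + b%:num) * r.
  rewrite ler_pdivrMl //; apply: le_trans total_le _.
  rewrite -LamE; move: fL; rewrite ler_pdivrMl // => fL.
  have P0 : 0 <= P%:R :> R by [].
  have := ler_wpM2l P0 fL; rewrite /rho; lra.
apply: le_trans avg_le _.
have PL : P%:R * L <= 5 / 2 * ln T%:R * L by rewrite ler_wpM2r.
(* Combines [1 <= |X| <= Gamma], [a + b <= 5 P (C + D)] and [P <= 5/2 ln T]. *)
have aX : a%:num * #|val X|%:R + b%:num <=
    25 / 2 * (ln T%:R * ((C%:num + D%:num) * Gamma)).
  apply: (@le_trans _ _ ((a%:num + b%:num) * #|val X|%:R)).
    by rewrite mulrDl lerD2l ler_peMr.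
  apply: (@le_trans _ _ ((5 * P%:R * (C%:num + D%:num)) * Gamma)).
    apply: ler_pM => //; rewrite aE bE.
    have PC : C%:num <= P%:R * C%:num by rewrite ler_peMl.
    have PD : D%:num <= P%:R * D%:num by rewrite ler_peMl.
    by move: PC PD; lra.
  have CDG : 0 <= (C%:num + D%:num) * Gamma by rewrite mulr_ge0 // ltW.
  by have := ler_wpM2r CDG PlnT; lra.
have aX0 : 0 <= a%:num * #|val X|%:R + b%:num by rewrite addr_ge0 // mulr_ge0 // ltW.
have := ler_pM aX0 r0 aX r_le.
have LT0 : 0 <= ln T%:R * L by rewrite mulr_ge0 //; lra.
by move: PL LT0; lra.
Qed.
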